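(* The isomorphisms in the category $\mathbf{Clus}$ of rooted cluster algebras and rooted cluster morphisms coincide with the bijective rooted cluster morphisms.
   Context: Countable means of cardinality at most $\aleph_0$; rings are unital and ring homomorphisms preserve identities. A seed is a triple $\Sigma=(\mathbf{x},\mathbf{ex},B)$ where $\mathbf{x}$ is a countable set of indeterminates over $\mathbb{Z}$ (the cluster), $\mathbf{ex}\subset\mathbf{x}$ is the set of exchangeable variables (those in $\mathbf{x}\setminus\mathbf{ex}$ are frozen), and $B=(b_{xy})_{x,y\in\mathbf{x}}$ is an integer matrix which is locally finite (each row and column has finite support) and skew-symmetrisable (there are positive integers $d_x$ with $d_xb_{xy}=-d_yb_{yx}$). Put $\mathcal{F}_\Sigma=\mathbb{Q}(x\mid x\in\mathbf{x})$. For $x\in\mathbf{ex}$ the mutation $\mu_x(\Sigma)=(\mathbf{x}',\mathbf{ex}',B')$ is obtained by replacing $x$ in $\mathbf{x}$ and in $\mathbf{ex}$ by $x'\in\mathcal{F}_\Sigma$ with $xx'=\prod_{b_{xy}>0}y^{b_{xy}}+\prod_{b_{xy}<0}y^{-b_{xy}}$, and (identifying the index $x'$ with $x$) $b'_{yz}=-b_{yz}$ if $x\in\{y,z\}$ and $b'_{yz}=b_{yz}+\frac12(|b_{yx}|b_{xz}+b_{yx}|b_{xz}|)$ otherwise. For $y\in\mathbf{x}$, $\mu_{x,\Sigma}(y)$ is the variable of $\mu_x(\Sigma)$ corresponding to $y$: it is $y$ if $y\ne x$ and $x'$ if $y=x$. A sequence $(x_1,\dots,x_l)$ is $\Sigma$-admissible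 if $x_1$ is exchangeable in $\Sigma$ and each $x_i$ ($i\ge2$) is exchangeable in $\mu_{x_{i-1}}\circ\cdots\circ\mu_{x_1}(\Sigma)$; $\mu_{x_l}\circ\cdots\circ\mu_{x_1,\Sigma}(y)$ denotes the variable corresponding to $y\in\mathbf{x}$ after these mutations. $\mathrm{Mut}(\Sigma)$ is the set of seeds obtained from $\Sigma$ by mutating along finite (possibly empty) admissible sequences. The rooted cluster algebra $\mathcal{A}(\Sigma)$ is the $\mathbb{Z}$-subalgebra of $\mathcal{F}_\Sigma$ generated by all variables in clusters of seeds in $\mathrm{Mut}(\Sigma)$, considered together with its initial seed $\Sigma$. For seeds $\Sigma=(\mathbf{x},\mathbf{ex},B)$, $\Sigma'=(\mathbf{x}',\mathbf{ex}',B')$ and a map $f:\mathcal{A}(\Sigma)\to\mathcal{A}(\Sigma')$, a sequence $(x_1,\dots,x_n)$ is $(f,\Sigma,\Sigma')$-biadmissible if it is $\Sigma$-admissible and $(f(x_1),\dots,f(x_n))$ is $\Sigma'$-admissible. A rooted cluster morphism $\mathcal{A}(\Sigma)\to\mathcal{A}(\Sigma')$ is a ring homomorphism $f$ such that (CM1) $f(\mathbf{x})\subset\mathbf{x}'\sqcup\mathbb{Z}$; (CM2) $f(\mathbf{ex})\subset\mathbf{ex}'\sqcup\mathbb{Z}$; (CM3) for every $(f,\Sigma,\Sigma')$-biadmissible sequence $(x_1,\dots,x_n)$ and every $y\in\mathbf{x}$, $f(\mu_{x_n}\circ\cdots\circ\mu_{x_1,\Sigma}(y))=\mu_{f(x_n)}\circ\cdots\circ\mu_{f(x_1),\Sigma'}(f(y))$,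 where mutations fix integers. $\mathbf{Clus}$ is the category whose objects are rooted cluster algebras and whose morphisms are rooted cluster morphisms. An isomorphism in $\mathbf{Clus}$ is a morphism having an inverse that is itself a rooted cluster morphism. *)

(* Defs.v *)
From HB Require Import structures.
From mathcomp Require Import all_boot all_order all_algebra.
From mathcomp Require Import finmap.
From mathcomp Require Import boolp classical_sets functions cardinality fsbigop.
From mathcomp Require Import (canonicals) mpoly.
From mathcomp Require Import monalg.

Set Implicit Arguments.
Unset Strict Implicit.
Unset Printing Implicit Defensive.

Import Order.TTheory GRing.Theory Num.Theory.
Local Open Scope classical_set_scope.
Local Open Scope ring_scope.

(* The library makes [{malg rat[{cmonom I}]}] a commutative ring, but not an
   integral domain, which is needed to form its field of fractions.  Absence of
   zero divisors is proved by mapping two given polynomials to a polynomial ring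
   in the finitely many variables that occur in them. *)
Definition polyQ (I : choiceType) : Type := {malg rat[{cmonom I}]}.

HB.instance Definition _ (I : choiceType) :=
  GRing.ComNzRing.copy (polyQ I) {malg rat[{cmonom I}]}.

Section PolyQDomain.
Variable I : choiceType.

Section ToMpoly.
Variable s : seq I.

Definition mpoly_exp (m : {cmonom I}) : mpoly.multinom (size s) :=
  mpoly.Multinom (mktuple (fun j => m (tnth (in_tuple s) j))).

Definition mpoly_mon (m : {cmonom I}) : mpoly.mpoly (size s) rat :=
  mpoly.mpolyX rat (mpoly_exp m).

Lemma mpoly_expE m j : mpoly.fun_of_multinom (mpoly_exp m) j = m (tnth (in_tuple s) j).
Proof. by rewrite mpoly.mnm_tnth tnth_mktuple. Qed.

Lemma mpoly_mon_morph : mmorphism mpoly_mon.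
Proof.
split=> [x y|]; rewrite /mpoly_mon.
  rewrite -mpoly.mpolyXD; congr mpoly.mpolyX; apply/mpoly.mnmP => j.
  by rewrite mpoly.mnmDE !mpoly_expE cmM.
rewrite -mpoly.mpolyX0; congr mpoly.mpolyX; apply/mpoly.mnmP => j.
by rewrite mpoly.mnm0E mpoly_expE cm1.
Qed.

HB.instance Definition _ :=
  isMultiplicative.Build {cmonom I} (mpoly.mpoly (size s) rat) mpoly_mon
    mpoly_mon_morph.

Definition to_mpoly (p : {malg rat[{cmonom I}]}) :=
  mmap (@mpoly.mpolyC (size s) rat) mpoly_mon p.

Lemma to_mpolyM p q : to_mpoly (p * q) = to_mpoly p * to_mpoly q.
Proof. exact: rmorphM. Qed.

Lemma to_mpoly_eq0 p :
  (forall (m : {cmonom I}) (i : I), m \in msupp p -> i \in finsupp m -> i \in s) ->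
  to_mpoly p = 0 -> p = 0.
Proof.
move=> ps p0; apply: contra_eq (p0) => /eqP pN0; apply/eqP => {}p0.
have [m mp] : exists m, m \in msupp p.
  apply/fset0Pn; apply/eqP => p0'; apply: pN0; apply/eqP.
  by rewrite -msupp_eq0 p0'.
have expI k : k \in msupp p -> mpoly_exp k = mpoly_exp m -> k = m.
  move=> kp ekm; apply/eqP/cmP => i.
  have [si|nsi] := boolP (i \in s).
    have := congr1 (fun e => mpoly.fun_of_multinom e (Ordinal (etrans (index_mem i s) si))) ekm.
    by rewrite !mpoly_expE (tnth_nth i) /= nth_index.
  have z k' : k' \in msupp p -> k' i = 0%N.
    move=> k'p; apply/eqP; rewrite cmE_eq0; apply: contra nsi; exact: ps.
  by rewrite !z.
move/(congr1 (mpoly.mcoeff (mpoly_exp m))): p0.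
rewrite /to_mpoly mmapE raddf_sum /= mpoly.mcoeff0 (big_fsetD1 m) //=.
rewrite mpoly.mcoeffCM mpoly.mcoeffX eqxx mulr1 big_seq big1 ?addr0 => [/eqP|k].
  by rewrite (negbTE (_ : p@_m != 0)) // mcoeff_neq0.
rewrite !inE => /andP[km kp]; rewrite mpoly.mcoeffCM mpoly.mcoeffX.
by case: eqP => [/(expI _ kp) e|_]; rewrite ?mulr0 //; rewrite e eqxx in km.
Qed.
End ToMpoly.

Lemma polyQ_domain (p q : polyQ I) : p * q = 0 -> (p == 0) || (q == 0).
Proof.
move=> pq0.
pose ms : seq {cmonom I} := (msupp p : seq _) ++ msupp q.
pose s := flatten [seq (finsupp (cmonom_val m) : seq I) | m <- ms].
have: to_mpoly s p * to_mpoly s q == 0 by rewrite -to_mpolyM pq0 /to_mpoly raddf0.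
have ss (m : {cmonom I}) i : m \in ms -> i \in finsupp m -> i \in s.
  by move=> mpq im; apply/flatten_mapP; exists m.
rewrite mulf_eq0 => /orP[] /eqP /to_mpoly_eq0 -> //; rewrite ?eqxx ?orbT // => m i mp;
  by apply: ss; rewrite mem_cat mp ?orbT.
Qed.

Definition polyQ_unit : {pred polyQ I} := [pred p | `[< exists q, q * p = 1 >]].

Definition polyQ_inv (p : polyQ I) : polyQ I :=
  if pselect (exists q, q * p = 1) is left e then projT1 (cid e) else p.

Fact polyQ_mulVr : {in polyQ_unit, left_inverse 1 polyQ_inv *%R}.
Proof.
move=> p /asboolP pU; rewrite /polyQ_inv.
by case: pselect => // e; case: (cid e).
Qed.

Fact polyQ_unitPl p q : q * p = 1 -> p \in polyQ_unit.
Proof. by move=> qp1; apply/asboolP; exists q. Qed.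

Fact polyQ_invr_out : {in [predC polyQ_unit], polyQ_inv =1 id}.
Proof.
move=> p /asboolP pU; rewrite /polyQ_inv; by case: pselect.
Qed.

HB.instance Definition _ := GRing.ComNzRing_hasMulInverse.Build (polyQ I)
  polyQ_mulVr polyQ_unitPl polyQ_invr_out.
HB.instance Definition _ :=
  GRing.ComUnitRing_isIntegral.Build (polyQ I) polyQ_domain.
End PolyQDomain.

(* Q(X_i | i in I) *)
Definition ratfun (I : choiceType) : fieldType := {fraction (polyQ I)}.

Definition indet (I : choiceType) (i : I) : ratfun I :=
  tofrac (mkmalgU (ucm i) 1 : polyQ I).

(* Seeds in an ambient field.  The matrix is given on all of F, but only its
   entries indexed by the cluster are meaningful. *)
Record seed_in (F : fieldType) := SeedIn {
  cluster : set F;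
  exch : set F;
  bmat : F -> F -> int }.

Section Mutation.
Variable F : fieldType.
Implicit Types (S : seed_in F) (x y : F) (s : seq F).

(* The products range over the finitely many variables with nonzero exponent. *)
Definition exchanged S x : F :=
  (\big[*%R/1]_(y \in [set y | cluster S y /\ 0 < bmat S x y])
      y ^+ `|bmat S x y|%N
   + \big[*%R/1]_(y \in [set y | cluster S y /\ bmat S x y < 0])
      y ^+ `|bmat S x y|%N) / x.

(* The variable of mu_x(S) corresponding to the variable y of S.  Integers are
   left fixed, since they are never equal to the cluster variable x. *)
Definition mutvar S x y : F := if y == x then exchanged S x else y.

(* Conversely, the variable of S that indexes the row of a variable of mu_x(S) *)
Definition unmutvar S x y : F := if y == exchanged S x then x else y.

Definition mutate S x : seed_in F := SeedIn
  (mutvar S x @` cluster S)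
  (mutvar S x @` exch S)
  (fun u v =>
     let y := unmutvar S x u in let z := unmutvar S x v in
     if (x == y) || (x == z) then - bmat S y z
     else bmat S y z
       + ((`|bmat S y x| * bmat S x z + bmat S y x * `|bmat S x z|) %/ 2)%Z).

Fixpoint admissible S s : Prop :=
  if s is x :: s' then exch S x /\ admissible (mutate S x) s' else True.

Fixpoint mutations S s : seed_in F :=
  if s is x :: s' then mutations (mutate S x) s' else S.

(* mu_{x_l} o ... o mu_{x_1,S} (y) for s = (x_1, ..., x_l) *)
Fixpoint mutvars S s y : F :=
  if s is x :: s' then mutvars (mutate S x) s' (mutvar S x y) else y.

Definition Mut S : set (seed_in F) :=
  [set T | exists2 s, admissible S s & T = mutations S s].

Definition cluster_variables S : set F := [set z | exists2 T, Mut S T & cluster T z].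

Lemma mutvars_cluster S s y : cluster S y -> cluster (mutations S s) (mutvars S s y).
Proof. by elim: s S y => //= x s IHs S y Sy; apply: IHs; exists y. Qed.

Definition cluster_alg S : {pred F} := fun a =>
  `[< smallest [set A : set F | subring_closed [in A]] (cluster_variables S) a >].

Fact cluster_alg_subring S : subring_closed (cluster_alg S).
Proof.
split=> [|a b|a b].
- by apply/asboolP => A [[A1 _ _] _]; move: A1; rewrite inE.
- move=> /asboolP Sa /asboolP Sb; apply/asboolP => A hA.
  have [[_ AB _] _] := hA.
  by have := AB a b; rewrite !inE; apply; [exact: Sa|exact: Sb].
- move=> /asboolP Sa /asboolP Sb; apply/asboolP => A hA.
  have [[_ _ AM] _] := hA.
  by have := AM a b; rewrite !inE; apply; [exact: Sa|exact: Sb].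
Qed.

HB.instance Definition _ S :=
  GRing.isSubringClosed.Build F (cluster_alg S) (cluster_alg_subring S).

Lemma mutvars_in_cluster_alg S s y :
  admissible S s -> cluster S y -> mutvars S s y \in cluster_alg S.
Proof.
move=> Ss Sy; apply/asboolP => A [_]; apply; exists (mutations S s).
  by exists s.
exact: mutvars_cluster.
Qed.
End Mutation.

(* Initial seeds: the cluster is a countable set of indeterminates and the
   ambient field is the field of rational functions in them. *)
Record seed := Seed {
  index : countType;
  seed_data :> seed_in (ratfun index);
  cluster_indet : cluster seed_data = range (@indet index);
  exch_sub : exch seed_data `<=` cluster seed_data;
  row_finite : forall x, cluster seed_data x ->
    finite_set [set y | cluster seed_data y /\ bmat seed_data x y != 0];
  col_finite : forall y, cluster seed_data y ->
    finite_set [set x | cluster seed_data x /\ bmat seed_data x y != 0];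
  skew_symmetrisable : exists d : ratfun index -> int,
    (forall x, cluster seed_data x -> 0 < d x) /\
    (forall x y, cluster seed_data x -> cluster seed_data y ->
       d x * bmat seed_data x y = - (d y * bmat seed_data y x)) }.

(* The rooted cluster algebra A(S), as a ring *)
Record rca (S : seed) := RCA {
  rca_val : ratfun (index S);
  _ : rca_val \in cluster_alg S }.

HB.instance Definition _ S := [isSub for @rca_val S].
HB.instance Definition _ S := [Choice of rca S by <:].
HB.instance Definition _ S :=
  [SubChoice_isSubComNzRing of rca S by <:].

Definition biadmissible (S S' : seed) (f : rca S -> rca S') (s : seq (rca S)) :=
  admissible S (map val s) /\ admissible S' (map val (map f s)).

(* In rcm_CM3, z is the element mu_{x_n} o ... o mu_{x_1,S} (y) of A(S), which
   exists by mutvars_in_cluster_alg. *)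
Record rooted_cluster_morphism (S S' : seed) := RootedClusterMorphism {
  rcm_fun :> {rmorphism rca S -> rca S'};
  rcm_CM1 : forall x : rca S, cluster S (val x) ->
    cluster S' (val (rcm_fun x)) \/ exists m : int, rcm_fun x = m%:~R;
  rcm_CM2 : forall x : rca S, exch S (val x) ->
    exch S' (val (rcm_fun x)) \/ exists m : int, rcm_fun x = m%:~R;
  rcm_CM3 : forall s : seq (rca S), biadmissible rcm_fun s ->
    forall y : rca S, cluster S (val y) ->
    forall z : rca S, val z = mutvars S (map val s) (val y) ->
      val (rcm_fun z) = mutvars S' (map val (map rcm_fun s)) (val (rcm_fun y)) }.

Definition Clus_isomorphism (S S' : seed) (f : rooted_cluster_morphism S S') :=
  exists g : rooted_cluster_morphism S' S, cancel f g /\ cancel g f.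

(* Main.v *)
Require Import Defs.
From HB Require Import structures.
From mathcomp Require Import all_boot all_order all_algebra.
From mathcomp Require Import finmap.
From mathcomp Require Import boolp classical_sets fsbigop.
From mathcomp Require Import monalg.

(* Extend a bijective f to an embedding of the fields of fractions.  A variable
   X_j of S' outside f(x) would be f(a) with a rational in x, hence rational in
   variables other than X_j; so f maps the cluster onto the cluster.  If the
   frozen variable x = X_i were sent to an exchangeable one, A(S) would contain
   (M1 + M2) / x; but at the point X_i = 0, X_k = 1 (k <> i) all elements of A(S)
   are regular, and M1 + M2 is positive since x divides at most one of M1, M2.
   So f also maps exchangeable variables onto exchangeable variables, and CM3 for
   the inverse is CM3 for f read backwards. *)

Set Implicit Arguments.
Unset Strict Implicit.
Unset Printing Implicit Defensive.

Import Order.TTheory GRing.Theory Num.Theory.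
Local Open Scope classical_set_scope.
Local Open Scope ring_scope.

(** * Closure properties of exchange relations and cluster algebras *)

Lemma fsbig_prod_closed (R : comNzRingType) (T : choiceType) (P : R -> Prop)
    (A : set T) (F : T -> R) :
  P 1 -> (forall a b, P a -> P b -> P (a * b)) -> (forall i, A i -> P (F i)) ->
  P (\big[*%R/1]_(i \in A) F i).
Proof.
(* By convention the product is 1 when infinitely many factors differ from 1. *)
move=> P1 PM PF; case: finite_supportP => [_|X XA _ _]; first by rewrite big_nil.
by rewrite big_seq; apply: big_ind => // i iX; apply/PF/XA.
Qed.

Lemma exp_closed (R : comNzRingType) (P : R -> Prop) (a : R) n :
  P 1 -> (forall a b, P a -> P b -> P (a * b)) -> P a -> P (a ^+ n).
Proof. by move=> P1 PM Pa; elim: n => // n IHn; rewrite exprS; apply: PM. Qed.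

Section SeedLemmas.
Variable F : fieldType.
Implicit Types (S T : seed_in F).

(* A variable [z] occurs in at most one of the two monomials of an exchange
   relation, so the sum remains positive even if [z] is only nonnegative. *)
Lemma exchange_relation_pos T x z (Pos NN : F -> Prop) :
  Pos 1 -> (forall a b, Pos a -> Pos b -> Pos (a * b)) ->
  (forall a b, NN a -> NN b -> NN (a * b)) ->
  (forall a, Pos a -> NN a) -> (forall a b, Pos a -> NN b -> Pos (a + b)) ->
  NN z -> (forall y, cluster T y -> y <> z -> Pos y) ->
  x != 0 -> Pos (exchanged T x * x).
Proof.
move=> P1 PM NM PN PD Nz Py x0; rewrite /exchanged divfK //.
have NNy y : cluster T y -> NN y by have [->//|/eqP yz Ty] := eqVneq y z; apply/PN/Py.
have mon_nn (A : set F) : A `<=` cluster T ->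
    NN (\big[*%R/1]_(y \in A) y ^+ `|bmat T x y|%N).
  move=> AT; apply: fsbig_prod_closed => //; first exact: PN.
  by move=> y /AT Ty; apply: exp_closed => //; [exact: PN|exact: NNy].
have mon_pos (A : set F) : A `<=` cluster T -> ~ A z ->
    Pos (\big[*%R/1]_(y \in A) y ^+ `|bmat T x y|%N).
  move=> AT Az; apply: fsbig_prod_closed => // y Ay; apply: exp_closed => //.
  by apply: Py; [exact: AT|move=> yz; rewrite yz in Ay].
(* If the entry at [z] is positive, the monomial of negative entries omits [z]; otherwise the
   monomial of positive entries does. *)
have [bz|bz] := ltP 0 (bmat T x z).
  rewrite addrC; apply: PD; last by apply: mon_nn => y [].
  by apply: mon_pos => [y []|[_]] //; rewrite ltNge (ltW bz).
apply: PD; last by apply: mon_nn => y [].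
by apply: mon_pos => [y []|[_]] //; rewrite ltNge bz.
Qed.

(** [E] bounds whole clusters and [G] only their exchangeable variables: a frozen variable may lack
    a property that is required of the variables one divides by. *)
Lemma mutations_closed (E G : set F) : G `<=` E ->
  (forall T x, cluster T `<=` E -> exch T `<=` G -> exch T x -> G (exchanged T x)) ->
  forall s S, cluster S `<=` E -> exch S `<=` G -> admissible S s ->
  cluster (mutations S s) `<=` E.
Proof.
move=> GE EG; elim=> //= x s IHs S SE SG [Sx]; apply: IHs.
  by move=> _ [y Sy <-]; rewrite /mutvar; case: eqP => _; [apply/GE/EG|apply/SE].
by move=> _ [y Sy <-]; rewrite /mutvar; case: eqP => _; [apply/EG|apply/SG].
Qed.

(** All cluster variables lie in [E], so the subring [A] contains the ring that they generate. *)
Lemma cluster_alg_closed (E G : set F) S : G `<=` E ->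
  (forall T x, cluster T `<=` E -> exch T `<=` G -> exch T x -> G (exchanged T x)) ->
  cluster S `<=` E -> exch S `<=` G ->
  forall A : set F, E `<=` A -> A 1 -> (forall a b, A a -> A b -> A (a - b)) ->
  (forall a b, A a -> A b -> A (a * b)) ->
  forall a, a \in cluster_alg S -> A a.
Proof.
move=> GE EG SE SG A EA A1 AB AM a /asboolP; apply; split=> /=.
  by split=> [|u v|u v]; rewrite !inE //; [exact: AB|exact: AM].
by move=> z [_ [s Ss ->] zs]; apply/EA/(mutations_closed GE EG SE SG Ss).
Qed.

Lemma cluster_in_alg S y : cluster S y -> y \in cluster_alg S.
Proof. exact: (@mutvars_in_cluster_alg _ S [::]). Qed.

Lemma exchanged_in_alg S x :
  exch S `<=` cluster S -> exch S x -> exchanged S x \in cluster_alg S.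
Proof.
move=> Sxc Sx; have := @mutvars_in_cluster_alg _ S [:: x] x (conj Sx I) (Sxc _ Sx).
by rewrite /= /mutvar eqxx.
Qed.

End SeedLemmas.

Local Notation "p %:F" := (tofrac p).

(** * Fractions compatible with an embedding *)

Section FractionsOver.
Variables (R : comNzRingType) (F F' : fieldType).
Variables (v : {rmorphism R -> F}) (g : {rmorphism R -> F'}) (D : set F').
Hypotheses (D1 : D 1) (DB : forall a b, D a -> D b -> D (a - b)).
Hypotheses (DM : forall a b, D a -> D b -> D (a * b)) (DV : forall a, D a -> D a^-1).
Hypothesis g_inj : injective g.

(** Plays the role of the preimage of [D] under the extension of [g] to fractions, without
    constructing that extension as a map. *)
Definition fractions_over (u : F) := exists p q : R,
  [/\ v q != 0, u * v q = v p, D (g p) & D (g q)].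

Lemma fractions_over_val p : D (g p) -> fractions_over (v p).
Proof. by exists p, 1; rewrite !rmorph1 mulr1 oner_eq0. Qed.

Lemma fractions_over1 : fractions_over 1.
Proof. by rewrite -(rmorph1 v); apply: fractions_over_val; rewrite rmorph1. Qed.

Lemma fractions_overM a b :
  fractions_over a -> fractions_over b -> fractions_over (a * b).
Proof.
move=> [p [q [q0 aq Dp Dq]]] [p' [q' [q'0 bq' Dp' Dq']]]; exists (p * p'), (q * q').
by rewrite !rmorphM mulf_neq0 // mulrACA aq bq'; split=> //; apply: DM.
Qed.

Lemma fractions_overB a b :
  fractions_over a -> fractions_over b -> fractions_over (a - b).
Proof.
move=> [p [q [q0 aq Dp Dq]]] [p' [q' [q'0 bq' Dp' Dq']]].
exists (p * q' - p' * q), (q * q'); rewrite !rmorphB !rmorphM mulf_neq0 //; split=> //.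
- by rewrite mulrBl mulrA aq [v q * _]mulrC mulrA bq'.
- by apply: DB; apply: DM.
- exact: DM.
Qed.

Lemma fractions_overV a : fractions_over a -> fractions_over a^-1.
Proof.
have [->|a0] := eqVneq a 0; first by rewrite invr0.
by move=> [p [q [q0 aq Dp Dq]]]; exists q, p; rewrite -aq mulf_neq0 // mulKf.
Qed.

(** Injectivity of [v] turns [v a * v q = v p] into [a * q = p]; hence [g a] is the quotient of
    [g p] by [g q], which is nonzero because [g] is injective. *)
Lemma fractions_over_map a : injective v -> fractions_over (v a) -> D (g a).
Proof.
move=> v_inj [p [q [q0 /eqP]]]; rewrite -rmorphM => /eqP /v_inj <- Dp Dq.
have q0' : g q != 0 by move: q0; rewrite -(rmorph0 v) -(rmorph0 g) !inj_eq.
by rewrite -(mulfK q0' (g a)) -rmorphM; apply/DM/DV.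
Qed.

End FractionsOver.

(** * Values of fractions in a residue field *)

Section Value.
Variables (D : idomainType) (K : fieldType) (ev : {rmorphism D -> K}).
Implicit Types (a b : {fraction D}) (r t : K).

(* [a] lies in the localisation at the kernel of [ev], and takes the value [r]
   in the residue field. *)
Definition has_value a r := exists P Q : D,
  [/\ ev Q != 0, a * Q%:F = P%:F & ev P = r * ev Q].

Lemma has_value_poly (P : D) : has_value P%:F (ev P).
Proof. by exists P, 1; rewrite rmorph1 oner_neq0 tofrac1 !mulr1. Qed.

Lemma has_value1 : has_value 1 1.
Proof. by have := has_value_poly 1; rewrite tofrac1 rmorph1. Qed.

Lemma has_valueM a b r t : has_value a r -> has_value b t -> has_value (a * b) (r * t).
Proof.
move=> [P [Q [Q0 aQ eP]]] [P' [Q' [Q'0 bQ eP']]]; exists (P * P'), (Q * Q').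
rewrite !(rmorphM ev); split; first by rewrite mulf_neq0.
  by rewrite !tofracM mulrACA aQ bQ.
by rewrite eP eP' mulrACA.
Qed.

Lemma has_valueN a r : has_value a r -> has_value (- a) (- r).
Proof.
by move=> [P [Q [Q0 aQ eP]]]; exists (- P), Q; rewrite tofracN (rmorphN ev) !mulNr aQ eP.
Qed.

Lemma has_valueD a b r t : has_value a r -> has_value b t -> has_value (a + b) (r + t).
Proof.
move=> [P [Q [Q0 aQ eP]]] [P' [Q' [Q'0 bQ eP']]].
exists (P * Q' + P' * Q), (Q * Q'); rewrite tofracD !tofracM (rmorphD ev) !(rmorphM ev).
split; first by rewrite mulf_neq0.
  by rewrite mulrDl mulrA aQ [Q%:F * _]mulrC mulrA bQ.
by rewrite mulrDl eP eP' -!mulrA [ev Q' * _]mulrC.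
Qed.

Lemma has_valueV a r : r != 0 -> has_value a r -> has_value a^-1 r^-1.
Proof.
move=> r0 [P [Q [Q0 aQ eP]]]; exists Q, P; rewrite eP mulf_neq0 // mulKf //.
(* If [a = 0] then [P = 0], whereas [ev P = r * ev Q] is nonzero. *)
split=> //; rewrite -aQ; have [a0|a0] := eqVneq a 0; last by rewrite mulKf.
have /eqP := aQ; rewrite a0 mul0r eq_sym tofrac_eq0 => /eqP P0.
by move/eqP: eP; rewrite P0 rmorph0 eq_sym mulf_eq0 (negbTE r0) (negbTE Q0).
Qed.

(** Cross-multiply the two representations, apply [ev], and cancel the nonzero values of the
    denominators. *)
Lemma has_value_inj a r t : has_value a r -> has_value a t -> r = t.
Proof.
move=> [P [Q [Q0 aQ eP]]] [P' [Q' [Q'0 aQ' eP']]].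
have : (P * Q')%:F = (P' * Q)%:F.
  by rewrite !tofracM -aQ -aQ' mulrAC.
move/eqP; rewrite tofrac_eq => /eqP /(congr1 ev); rewrite !(rmorphM ev) eP eP'.
by rewrite mulrAC; move/(mulIf Q0)/(mulIf Q'0).
Qed.

Lemma has_value_int (m : int) : has_value m%:~R m%:~R.
Proof.
by have := has_value_poly m%:~R; rewrite (rmorph_int (@tofrac D)) (rmorph_int ev).
Qed.

End Value.

(** * Two specialisations of the indeterminates *)

Section Substitutions.
Variables (I : choiceType) (j : I).

(* The substitution [X_j := 0]. *)
Definition kill_mon (m : {cmonom I}) : polyQ I :=
  if m j == 0%N then mkmalgU m 1 else 0.

Lemma kill_mon_morph : mmorphism kill_mon.
Proof.
split=> [x y|]; rewrite /kill_mon ?cm1 ?eqxx // cmM addn_eq0.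
case: eqP => _; rewrite ?mul0r //=; case: eqP => _; rewrite ?mulr0 //.
by rewrite malgM_def fgmulUU mulr1.
Qed.

HB.instance Definition _ :=
  isMultiplicative.Build {cmonom I} (polyQ I) kill_mon kill_mon_morph.

Definition kill : polyQ I -> polyQ I := mmap (@malgC {cmonom I} rat) kill_mon.
HB.instance Definition _ :=
  GRing.RMorphism.copy kill (mmap (@malgC {cmonom I} rat) kill_mon).

(* Evaluation at the point [X_j = 0], [X_i = 1] for [i != j]. *)
Definition eval01_mon (m : {cmonom I}) : rat := (m j == 0%N)%:R.

Lemma eval01_mon_morph : mmorphism eval01_mon.
Proof.
split=> [x y|]; rewrite /eval01_mon ?cm1 ?eqxx // cmM addn_eq0.
by rewrite -natrM mulnb.
Qed.

HB.instance Definition _ :=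
  isMultiplicative.Build {cmonom I} rat eval01_mon eval01_mon_morph.

Definition eval01 : polyQ I -> rat := mmap (@idfun rat) eval01_mon.
HB.instance Definition _ := GRing.RMorphism.copy eval01 (mmap (@idfun rat) eval01_mon).

Definition varp (i : I) : polyQ I := mkmalgU (ucm i) 1.

Lemma kill_varp i : kill (varp i) = if i == j then 0 else varp i.
Proof.
rewrite /kill mmapU [LHS]mul1r /kill_mon cmU.
by case: (i == j).
Qed.

Lemma eval01_varp i : eval01 (varp i) = (i != j)%:R.
Proof. by rewrite /eval01 mmapU [LHS]mul1r /eval01_mon cmU; case: (i == j). Qed.

Lemma varp_neq0 : varp j != 0.
Proof.
apply/eqP => /(congr1 (fun p : {malg rat[{cmonom I}]} => p@_(ucm j))).
by rewrite mcoeffUU mcoeff0.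
Qed.

(** [kill] is followed by the embedding into fractions because values live in a field. *)
Lemma has_value_kill i :
  has_value (@tofrac (polyQ I) \o kill) (indet i) (if i == j then 0 else indet i).
Proof.
have := has_value_poly (@tofrac (polyQ I) \o kill) (varp i).
by rewrite /= kill_varp; case: eqP => // _; rewrite tofrac0.
Qed.

Lemma has_value_eval01 i : has_value eval01 (indet i) (i != j)%:R.
Proof. by rewrite -eval01_varp; exact: has_value_poly. Qed.

(** Evaluation at [X_j = 0] forces [m = 0], but an indeterminate is nonzero. *)
Lemma indet_neq_int (m : int) : indet j != m%:~R.
Proof.
apply/eqP => E; have := has_value_eval01 j; rewrite eqxx => v0.
have := has_value_int eval01 m; rewrite -E => /has_value_inj /(_ v0) /eqP.
rewrite intr_eq0 => /eqP m0; move/eqP: E; rewrite m0 tofrac_eq0.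
exact/negP/varp_neq0.
Qed.

End Substitutions.

Lemma cluster_indetP (T : seed) y : cluster T y <-> exists i, y = @indet (Defs.index T) i.
Proof.
by rewrite cluster_indet; split=> [[i _ <-]|[i ->]]; exists i.
Qed.

Lemma val1 (T : seed) : val (1 : rca T) = 1. Proof. exact: rmorph1. Qed.
Lemma valD (T : seed) (p q : rca T) : val (p + q) = val p + val q.
Proof. exact: rmorphD. Qed.
Lemma valM (T : seed) (p q : rca T) : val (p * q) = val p * val q.
Proof. exact: rmorphM. Qed.

Lemma val_int (T : seed) (m : int) : val (m%:~R : rca T) = m%:~R.
Proof. exact: rmorph_int. Qed.

Lemma cluster_non_int (T : seed) (x : rca T) (m : int) : cluster T (val x) -> x <> m%:~R.
Proof.
move=> /cluster_indetP [i xi] xm; have /eqP := indet_neq_int i m.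
by rewrite -xi xm val_int.
Qed.

(** * Initial variables under an injective, then bijective, morphism *)

Section Morphism.
Variables (S S' : seed) (f : rooted_cluster_morphism S S').
Hypothesis f_inj : injective f.

Lemma image_non_int (x : rca S) (m : int) : cluster S (val x) -> f x <> m%:~R.
Proof.
move=> Sx fxm; apply: (@cluster_non_int S x m Sx).
by apply: f_inj; rewrite fxm rmorph_int.
Qed.

Lemma image_cluster (x : rca S) : cluster S (val x) -> cluster S' (val (f x)).
Proof. by move=> Sx; case: (rcm_CM1 f Sx) => // -[m /image_non_int]; case. Qed.

(* [f] extends to the fraction field of its domain, which the initial variables
   generate as a field. *)
Lemma image_closed (D : set (ratfun (Defs.index S'))) :
  D 1 -> (forall a b, D a -> D b -> D (a - b)) -> (forall a b, D a -> D b -> D (a * b)) ->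
  (forall a, D a -> D a^-1) ->
  (forall x : rca S, cluster S (val x) -> D (val (f x))) ->
  forall a : rca S, D (val (f a)).
Proof.
move=> D1 DB DM DV Df a.
pose R := rca S; pose v : {rmorphism R -> ratfun (Defs.index S)} := val.
pose g : {rmorphism R -> ratfun (Defs.index S')} := val \o f.
have g_inj : injective g by move=> x y /val_inj /f_inj.
pose E := fractions_over v g D.
have EM u w : E u -> E w -> E (u * w) by exact: fractions_overM.
have E1 : E 1 by exact: fractions_over1.
have EB u w : E u -> E w -> E (u - w) by exact: fractions_overB.
have ED u w : E u -> E w -> E (u + w).
  move=> Eu Ew; rewrite -[w]opprK -(sub0r w) -(subrr 1).
  exact: (EB _ _ Eu (EB _ _ (EB _ _ E1 E1) Ew)).
have Ecl : cluster S `<=` E.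
  move=> y Sy; pose x : rca S := RCA (cluster_in_alg Sy).
  exact: (@fractions_over_val _ _ _ v g D D1 x (Df x Sy)).
(* An exchange uses only products, one sum and one quotient, so closure under field operations
   suffices. *)
have Eexch (T : seed_in (ratfun (Defs.index S))) x : cluster T `<=` E -> exch T `<=` E ->
    exch T x -> E (exchanged T x).
  move=> TE TE' Tx; apply: (EM); last exact/fractions_overV/TE'.
  apply: ED; apply: (fsbig_prod_closed E1 EM) => y [/TE Ey _];
    exact: (exp_closed _ E1 EM).
apply: (@fractions_over_map _ _ _ v g D DM DV g_inj a val_inj).
have Sexch : exch S `<=` E by move=> x /exch_sub /Ecl.
exact: (cluster_alg_closed (@subset_refl _ E) Eexch Ecl Sexch (@subset_refl _ E) E1 EB EM
  (valP a)).
Qed.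

Hypothesis f_surj : forall y, exists x, f x = y.

(* A variable [X_i] of the target outside the image of the cluster would be
   fixed by [X_i := 0], since all elements of the image of [f] are. *)
Lemma cluster_in_image y : cluster S' y ->
  exists2 x : rca S, cluster S (val x) & val (f x) = y.
Proof.
move=> S'y; have /cluster_indetP [i yi] := S'y; apply: contrapT => no_x.
pose ev : {rmorphism polyQ (Defs.index S') -> ratfun (Defs.index S')} :=
  @tofrac (polyQ (Defs.index S')) \o kill i.
pose D : set (ratfun (Defs.index S')) := fun u => has_value ev u u.
have [x fx] := f_surj (RCA (cluster_in_alg S'y)).
have : D (val (f x)).
  apply: image_closed => [|a b Da Db|a b Da Db|a Da|{fx}x Sx].
  - exact: has_value1.
  - exact/has_valueD/has_valueN.
  - exact: has_valueM.
  - have [a0|a0] := eqVneq a 0; last exact: has_valueV.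
    by rewrite a0 invr0 -a0.
  - have /cluster_indetP [k fxk] := image_cluster Sx.
    have := has_value_kill i k; rewrite -fxk; case: eqP => // ki _.
    by case: no_x; exists x; rewrite // fxk ki -yi.
(* Now [X_i] has both values [X_i] and 0 under [X_i := 0], so it would vanish. *)
rewrite fx /= yi => /has_value_inj /(_ (has_value_kill i i)); rewrite eqxx => /eqP.
exact/negP/(indet_neq_int i 0).
Qed.

Lemma image_cluster_inv (x : rca S) : cluster S' (val (f x)) -> cluster S (val x).
Proof. by move=> /cluster_in_image [w Sw /val_inj /f_inj <-]. Qed.

Lemma image_exch_inv (x : rca S) : exch S' (val (f x)) -> exch S (val x).
Proof.
move=> S'x; have Sx := image_cluster_inv (exch_sub S'x).
have /cluster_indetP [i xi] := Sx; apply: contrapT => nSx.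
(* Signs are taken at the point where [x = X_i] is 0 and all other indeterminates are 1. *)
pose Pos u := exists2 r, 0 < r & has_value (eval01 i) u r.
pose NN u := exists2 r, 0 <= r & has_value (eval01 i) u r.
have P1 : Pos 1 by exists 1 => //; exact: has_value1.
have PM u w : Pos u -> Pos w -> Pos (u * w).
  by move=> [r r0 ur] [t t0 wt]; exists (r * t); [exact: mulr_gt0|exact: has_valueM].
have NM u w : NN u -> NN w -> NN (u * w).
  by move=> [r r0 ur] [t t0 wt]; exists (r * t); [exact: mulr_ge0|exact: has_valueM].
have PN u : Pos u -> NN u by move=> [r /ltW r0 ur]; exists r.
have PD u w : Pos u -> NN w -> Pos (u + w).
  by move=> [r r0 ur] [t t0 wt]; exists (r + t); [exact: ltr_wpDr|exact: has_valueD].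
have PV u : Pos u -> Pos u^-1.
  move=> [r r0 ur]; exists r^-1; first by rewrite invr_gt0.
  by apply: has_valueV => //; exact: lt0r_neq0.
have Nx : NN (val x).
  by exists 0 => //; rewrite xi; have := has_value_eval01 i i; rewrite eqxx.
have Sy y : cluster S y -> y <> val x -> Pos y.
  move=> /cluster_indetP [k ->]; rewrite xi => ki; exists 1; first exact: ltr01.
  have ki' : k != i by apply: contra_not_neq ki => ->.
  by have := has_value_eval01 i k; rewrite ki'.
have P0 u : Pos u -> u != 0.
  move=> [r r0 ur]; apply: contraTneq r0 => u0; rewrite u0 in ur.
  by rewrite (has_value_inj ur (has_value_int _ 0)) ltxx.
(* Being frozen, [x] is never divided by; every other variable reached by mutation stays positive at
   the point. *)
pose E : set (ratfun (Defs.index S)) := fun u => u <> val x -> Pos u.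
have Eexch (T : seed_in (ratfun (Defs.index S))) y : cluster T `<=` E ->
    exch T `<=` Pos -> exch T y -> Pos (exchanged T y).
  move=> TE TP Ty; have Py := TP _ Ty; rewrite -(mulfK (P0 _ Py) (exchanged T y)).
  apply: (PM) (PV _ Py).
  by apply: (exchange_relation_pos P1 PM NM PN PD Nx TE); apply: P0.
have PE : Pos `<=` E by move=> u Pu _.
have SE : cluster S `<=` E by exact: Sy.
have SP : exch S `<=` Pos.
  move=> y Ty; apply: (Sy); first exact: exch_sub.
  by move=> yx; rewrite yx in Ty.
pose A : set (ratfun (Defs.index S)) := fun u => exists r, has_value (eval01 i) u r.
have EA : E `<=` A.
  move=> u Eu; have [->|/eqP/Eu [r _ ur]] := eqVneq u (val x); last by exists r.
  by have [r _ ?] := Nx; exists r.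
have A1 : A 1 by exists 1; exact: has_value1.
have AB u w : A u -> A w -> A (u - w).
  by move=> [r ur] [t wt]; exists (r - t); exact/has_valueD/has_valueN.
have AM u w : A u -> A w -> A (u * w).
  by move=> [r ur] [t wt]; exists (r * t); exact: has_valueM.
have regular (a : rca S) : A (val a).
  exact: (cluster_alg_closed PE Eexch SE SP EA A1 AB AM (valP a)).
(* Signs are transported along [f], so that the exchange relation of [S'] at [f x] can be evaluated
   in the algebra of [S]. *)
pose Pos' u := exists2 a : rca S, val (f a) = u & Pos (val a).
pose NN' u := exists2 a : rca S, val (f a) = u & NN (val a).
(* [a] is the preimage of the exchanged variable, [b] that of the sum of the two monomials. *)
have [a fa] := f_surj (RCA (exchanged_in_alg (@exch_sub S') S'x)).
have [b fb [t t0 bt]] : Pos' (exchanged S' (val (f x)) * val (f x)).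
  apply: (@exchange_relation_pos _ S' (val (f x)) (val (f x)) Pos' NN').
  - by exists 1; rewrite ?rmorph1 ?val1.
  - move=> u w [p <- Pp] [q <- Pq]; exists (p * q); rewrite ?(rmorphM f) valM //.
    exact: PM.
  - move=> u w [p <- Pp] [q <- Pq]; exists (p * q); rewrite ?(rmorphM f) valM //.
    exact: NM.
  - by move=> u [p <- /PN]; exists p.
  - move=> u w [p <- Pp] [q <- Pq]; exists (p + q); rewrite ?(rmorphD f) valD //.
    exact: PD.
  - by exists x.
  - move=> y /cluster_in_image [w Sw <-] wx; exists w => //; apply: Sy => //.
    by move=> /val_inj wx'; apply: wx; rewrite wx'.
  - have /cluster_indetP [k ->] := exch_sub S'x.
    exact: (indet_neq_int k 0).
have ab : a * x = b.
  by apply: f_inj; apply: val_inj; rewrite fb (rmorphM f) valM fa.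
(* Since [a] is regular and [x] vanishes at the point, [a * x] has value 0 there, while [b] has the
   positive value [t]. *)
have [r ar] := regular a; have := has_valueM ar (has_value_eval01 i i).
rewrite -xi -valM ab eqxx mulr0 => /has_value_inj /(_ bt) t0'.
by rewrite -t0' ltxx in t0.
Qed.

End Morphism.

Theorem corollary3p10 (S S' : seed) (f : rooted_cluster_morphism S S') :
  Clus_isomorphism f <-> bijective f.
Proof.
split=> [[g [fK gK]]|[g fK gK]]; first by exists g.
have f_inj := can_inj fK.
have f_surj y : exists x, f x = y by exists (g y).
pose h : {rmorphism rca S' -> rca S} := HB.pack g
  (GRing.isZmodMorphism.Build _ _ g (can2_zmod_morphism fK gK))
  (GRing.isMonoidMorphism.Build _ _ g (can2_monoid_morphism fK gK)).
have CM1 (y : rca S') : cluster S' (val y) ->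
    cluster S (val (h y)) \/ exists m : int, h y = m%:~R.
  by move=> S'y; left; apply: (image_cluster_inv f_inj f_surj); rewrite /= gK.
have CM2 (y : rca S') : exch S' (val y) ->
    exch S (val (h y)) \/ exists m : int, h y = m%:~R.
  by move=> S'y; left; apply: (image_exch_inv f_inj f_surj); rewrite /= gK.
have CM3 (s : seq (rca S')) : biadmissible h s ->
    forall y : rca S', cluster S' (val y) ->
    forall z : rca S', val z = mutvars S' (map val s) (val y) ->
      val (h z) = mutvars S (map val (map h s)) (val (h y)).
  move=> [S's Ss] y S'y z zE.
  have fhs : map f (map h s) = s by rewrite -map_comp map_id_in // => a _ /=; rewrite gK.
  have Shy : cluster S (val (h y)).
    by apply: (image_cluster_inv f_inj f_surj); rewrite /= gK.
  (* [w] is what mutation along [map h s] makes of [h y]. CM3 for [f] gives [f w = z], hence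
     [h z = w]. *)
  pose w : rca S := RCA (mutvars_in_cluster_alg Ss Shy).
  have hs_biadm : biadmissible f (map h s) by split; rewrite ?fhs.
  have := rcm_CM3 hs_biadm Shy (z := w) erefl.
  by rewrite fhs /= gK -zE => /val_inj <-; rewrite fK.
by exists (RootedClusterMorphism CM1 CM2 CM3).
Qed.
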